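(* Let $n \geq 1$ and $k \geq 0$ be integers. If $\mathcal{F}$ is a locally $k$-wide family of subsets of an $n$-element set, then $|\mathcal{F}| \leq 2 + n + kn\ln(n)$.
   Context: A family $\mathcal{F}$ of subsets of a finite set $X$ is locally $k$-wide iff for every $x \in X$ every antichain (with respect to inclusion) of $\{U \in \mathcal{F} \mid x \in U\}$ has at most $k$ members. $\ln$ is the natural logarithm. *)

(* Defs.v *)
From mathcomp Require Import all_boot.

Set Implicit Arguments.
Unset Strict Implicit.
Unset Printing Implicit Defensive.

Definition antichain (X : finType) (A : {set {set X}}) : Prop :=
  forall U V : {set X}, U \in A -> V \in A -> U \subset V -> U = V.

Definition locally_wide (X : finType) (k : nat) (F : {set {set X}}) : Prop :=
  forall (x : X) (A : {set {set X}}),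
    A \subset [set U in F | x \in U] -> antichain A -> #|A| <= k.

(* Main.v *)
(** Members of equal size form an antichain, so at most [k] of the [i]-element
    members contain a given point. Counting incidences, there are at most
    [k n / i] members of size [i]. For [i >= 2] these bounds sum to at most
    [k n ln n]; at most one member is empty and at most [n] are singletons. *)
Require Import Defs.
From mathcomp Require Import all_boot all_order all_algebra.
From mathcomp Require Import reals exp.

Set Implicit Arguments.
Unset Strict Implicit.
Unset Printing Implicit Defensive.

Import Order.TTheory GRing.Theory Num.Theory.
Local Open Scope ring_scope.

Definition level (X : finType) (F : {set {set X}}) (i : nat) : {set {set X}} :=
  [set U in F | #|U| == i].

Lemma antichain_uniform (X : finType) (A : {set {set X}}) (i : nat) :
  (forall U, U \in A -> #|U| = i) -> antichain A.
Proof.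
move=> cardA U V UA VA sUV; apply/eqP.
by rewrite eqEcard sUV (cardA U) ?(cardA V) /=.
Qed.

Lemma card_sum_level (X : finType) (F : {set {set X}}) :
  #|F| = (\sum_(0 <= i < #|X|.+1) #|level F i|)%N.
Proof.
rewrite big_mkord -sum1_card.
(* [inord] never falls back to its default here, because [#|U|] is at most [#|X|]. *)
rewrite (partition_big (fun U : {set X} => inord #|U| : 'I_#|X|.+1) xpredT) //=.
apply: eq_bigr => i _; rewrite -[RHS]sum1_card; apply: eq_bigl => U.
by rewrite inE -val_eqE /= inordK // ltnS max_card.
Qed.

(** Serves the sizes 0 and 1, where the binomials are 1 and [#|X|]; larger sizes rely on width
    instead. *)
Lemma card_level_le_bin (X : finType) (F : {set {set X}}) (i : nat) :
  (#|level F i| <= 'C(#|X|, i))%N.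
Proof.
rewrite -card_draws; apply/subset_leq_card/subsetP => U.
by rewrite !inE => /andP[].
Qed.

Lemma locally_wide_level (X : finType) (k : nat) (F : {set {set X}}) (i : nat) :
  locally_wide k F -> (i * #|level F i| <= #|X| * k)%N.
Proof.
move=> wideF.
have -> : (i * #|level F i| = \sum_(U in level F i) \sum_(x in U) 1)%N.
  rewrite mulnC -sum_nat_const; apply: eq_bigr => U.
  by rewrite inE sum1_card => /andP[_ /eqP].
(* Double counting: after the swap it suffices that each point [x] lies in at most [k] members of
   the level. *)
rewrite (exchange_big_dep xpredT) //= -sum_nat_const.
apply: leq_sum => x _.
have -> : (\sum_(U in level F i | x \in U) 1 =
    #|[set U in level F i | x \in U]|)%N.
  by rewrite -sum1_card; apply: eq_bigl => U; rewrite !inE.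
apply: (wideF x).
  by apply/subsetP => U; rewrite !inE => /andP[/andP[-> _] ->].
by apply: (@antichain_uniform _ _ i) => U; rewrite !inE => /andP[/andP[_ /eqP]].
Qed.

(** Telescoping: [ln (1 + x) <= x] at [x = -1/(n+2)] bounds [1/(n+2)] by [ln (n+2) - ln (n+1)]. *)
Lemma harmonic_tail_le_ln (R : realType) (n : nat) :
  \sum_(2 <= i < n.+2) (i%:R : R)^-1 <= ln n.+1%:R.
Proof.
elim: n => [|n IHn]; first by rewrite big_geq // ln1.
rewrite big_nat_recr //=.
have n1_gt0 : 0 < n.+1%:R :> R by rewrite ltr0n.
have n2_gt0 : 0 < n.+2%:R :> R by rewrite ltr0n.
have ratioE : 1 + - n.+2%:R^-1 = n.+1%:R / n.+2%:R :> R.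
  apply: (mulIf (lt0r_neq0 n2_gt0)).
  by rewrite mulrBl mul1r mulVf ?divfK ?lt0r_neq0 // -natr1 addrK.
have : ln (n.+1%:R / n.+2%:R) <= - n.+2%:R^-1 :> R.
  by rewrite -ratioE le_ln1Dx // ltrN2 invf_lt1 ?ltr1n.
rewrite ln_div ?posrE // => ln_diff.
apply: le_trans (lerD IHn (lexx _)) _.
by rewrite -lerBrDl -opprB lerNr.
Qed.

Theorem theorem3p3p6 (R : realType) (n k : nat) (X : finType)
    (F : {set {set X}}) (hn : (1 <= n)%N) (hX : #|X| = n)
    (hF : locally_wide k F) :
  (#|F|%:R : R) <= 2%:R + n%:R + k%:R * n%:R * ln (n%:R : R).
Proof.
rewrite card_sum_level hX; case: n hn hX => // n _ hX.
(* The ground set now has [n.+1] points. Splitting off sizes 0 and 1 leaves [n] terms, the levels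
   [i.+2] for [i < n]. *)
rewrite big_nat_recl // big_nat_recl // addnA natrD.
apply: lerD.
  rewrite -natrD ler_nat leq_add //.
    by apply: leq_trans (card_level_le_bin F 0) _; rewrite bin0.
  by apply: leq_trans (card_level_le_bin F 1) _; rewrite bin1 hX.
(* With the logarithm replaced by the harmonic tail, the comparison can be made term by term. *)
apply: le_trans (ler_wpM2l _ (harmonic_tail_le_ln R n)); last first.
  by rewrite mulr_ge0.
rewrite !big_add1 /= natr_sum mulr_sumr; apply: ler_sum => i _.
rewrite ler_pdivlMr ?ltr0n // -!natrM ler_nat mulnC [leqRHS]mulnC -hX.
exact: locally_wide_level.
Qed.
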